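(* Consider an instance of MEFE-Matching with courses $X=\{x_1,\dots,x_n\}$ of capacities $c_1,\dots,c_n$ and TAs $T=\{t_1,\dots,t_m\}$ with $m\ge\sum_{i=1}^n c_i$, such that all TAs and courses positively value each other ($u_t(x)>0$ and $v_x(t)>0$ for all $t\in T$, $x\in X$), each TA assigns distinct valuations to the courses ($u_t(x)\ne u_t(y)$ for all $t\in T$ and distinct $x,y\in X$), and all the TAs have distinct grades in each course ($g_t(x)\ne g_{t'}(x)$ for all $x\in X$ and distinct $t,t'\in T$). Then a MEFE matching always exists for $k=1$.
   Context: An instance of MEFE-Matching consists of: a finite set of courses $X=\{x_1,\dots,x_n\}$; a finite set of TAs $T=\{t_1,\dots,t_m\}$; for each TA $t_i$ a utility (valuation) function $u_i=u_{t_i}\colon X\to\mathbb{Z}_{\ge 0}$ and a grade function $g_i=g_{t_i}\colon X\to\mathbb{Q}_{\ge 0}$; for each course $x_i$ a capacity $c_i$ (a positive integer) and a utility (valuation) function $v_i=v_{x_i}\colon T\to\mathbb{Z}_{\ge 0}$, where for every TA $t$ and course $x_i$ one has $v_i(t)=0$ if $u_t(x_i)=0$ and $v_i(t)>0$ otherwise; and a number $k\in\mathbb{Q}_{\ge 0}$. A matching is a function $\mu\colon T\to X\cup\{\emptyset\}$, where $\mu(t)=\emptyset$ means $t$ is unassigned; by convention $u_t(\emptyset)=0$. It is feasible if $|\mu^{-1}(x_i)|=c_i$ for every course $x_i$ and no TA $t$ is assigned to a course $x$ with $u_t(x)=0$. A MEFE (merit-based envy-free egalitarian) matching is a feasible matching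 $\mu$ such that (1) (satisfaction of courses) for every course $x_i$, $\mathrm{AvgUtil}(x_i)=\frac{1}{c_i}\sum_{t\in\mu^{-1}(x_i)}v_i(t)\ge k$; and (2) (merit-based envy-freeness) there are no two TAs $t_i,t_j$ with $\mu(t_j)\in X$, $g_i(\mu(t_j))\ge g_j(\mu(t_j))$ and $u_i(\mu(t_j))>u_i(\mu(t_i))$. *)

(* Defs.v *)
From mathcomp Require Import all_boot all_order all_algebra.

Set Implicit Arguments.
Unset Strict Implicit.
Unset Printing Implicit Defensive.

Import Order.TTheory GRing.Theory Num.Theory.

Local Open Scope ring_scope.

Record mefe_instance (X T : finType) := MefeInstance {
  ta_util : T -> X -> nat;
  grade : T -> X -> rat;
  capacity : X -> nat;
  course_util : X -> T -> nat;
  threshold : rat;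
  grade_ge0 : forall t x, 0 <= grade t x;
  capacity_gt0 : forall x, (0 < capacity x)%N;
  course_util_eq0 : forall x t, ta_util t x = 0%N -> course_util x t = 0%N;
  course_util_gt0 : forall x t, ta_util t x <> 0%N -> (0 < course_util x t)%N;
  threshold_ge0 : 0 <= threshold
}.

(* [None] means that the TA is unassigned. *)
Definition matching (X T : finType) := {ffun T -> option X}.

Section Mefe.

Variables (X T : finType) (I : mefe_instance X T).
Implicit Types (mu : matching X T) (t : T) (x : X).

Definition assigned mu x : {set T} := [set t | mu t == Some x].

Definition outcome_util t (o : option X) : nat :=
  if o is Some x then ta_util I t x else 0%N.

Definition feasible mu : Prop :=
  (forall x, #|assigned mu x| = capacity I x) /\
  (forall t x, mu t = Some x -> ta_util I t x <> 0%N).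

Definition avg_util mu x : rat :=
  (capacity I x)%:R^-1 * \sum_(t in assigned mu x) (course_util I x t)%:R.

Definition courses_satisfied mu : Prop :=
  forall x, threshold I <= avg_util mu x.

Definition merit_envy_free mu : Prop :=
  ~ exists ti tj x,
      [/\ mu tj = Some x,
          grade I tj x <= grade I ti x
        & (outcome_util ti (mu ti) < outcome_util ti (mu tj))%N].

Definition mefe_matching mu : Prop :=
  [/\ feasible mu, courses_satisfied mu & merit_envy_free mu].

End Mefe.

(* Main.v *)
Require Import Defs.
From mathcomp Require Import all_boot all_order all_algebra.

Import Order.TTheory GRing.Theory Num.Theory.

Local Open Scope ring_scope.

(** The empty matching is envy-free, since only assigned seats can be envied.
    Among the envy-free matchings that respect the capacities, take one that
    maximises the total utility of the TAs.  If some course [x] had a vacant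
    seat, then, as [\sum_x c_x <= m], some TA would be unassigned and hence
    prefer [x] to its outcome; moving the TA with the best grade in [x] among
    those who prefer [x] would create no envy and increase the total utility.
    So every course is full. *)

Section EnvyFree.

Variables (X T : finType) (I : mefe_instance X T).
Implicit Types (mu : matching X T) (t : T) (x : X).

Definition prefers mu t x : bool :=
  (outcome_util I t (mu t) < ta_util I t x)%N.

Definition within_capacity mu : bool :=
  [forall x, #|assigned mu x| <= capacity I x]%N.

(** The contrapositive form of [merit_envy_free], made boolean so that a maximum can be taken over
    the matchings that satisfy it. *)
Definition envy_free mu : bool :=
  [forall ti, forall tj, forall x,
    ((mu tj == Some x) && prefers mu ti x) ==> (grade I ti x < grade I tj x)].

Lemma envy_freeP mu :
  reflect (forall ti tj x, mu tj = Some x -> prefers mu ti x ->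
             grade I ti x < grade I tj x)
          (envy_free mu).
Proof.
apply: (iffP idP) => [/forallP ef ti tj x mux pref | ef].
  by move/(_ ti)/forallP/(_ tj)/forallP/(_ x)/implyP: ef; apply; rewrite mux eqxx.
apply/forallP => ti; apply/forallP => tj; apply/forallP => x.
by apply/implyP => /andP[/eqP mux]; apply: ef.
Qed.

Lemma envy_free_merit mu : envy_free mu -> merit_envy_free I mu.
Proof.
move=> /envy_freeP ef [ti [tj [x [mux le_g lt_u]]]].
have pref : prefers mu ti x by rewrite mux in lt_u.
by have := ef ti tj x mux pref; rewrite ltNge le_g.
Qed.

Definition total_util mu : nat := (\sum_t outcome_util I t (mu t))%N.

Definition reassign mu t x : matching X T :=
  [ffun s => if s == t then Some x else mu s].

Lemma total_util_reassign mu t x :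
  prefers mu t x -> (total_util mu < total_util (reassign mu t x))%N.
Proof.
move=> pref; rewrite /total_util (bigD1 t) //= [ltnRHS](bigD1 t) //= ffunE eqxx.
rewrite -addSn leq_add // leq_sum // => s /negPf s_t.
by rewrite ffunE s_t.
Qed.

(** The course [x] gains at most [t], for which the vacancy leaves room; any other course can only
    lose [t]. *)
Lemma within_capacity_reassign mu t x :
  within_capacity mu -> (#|assigned mu x| < capacity I x)%N ->
  within_capacity (reassign mu t x).
Proof.
move=> /forallP cap vacant; apply/forallP => y.
have [-> | y_x] := eqVneq y x.
  have sub : assigned (reassign mu t x) x \subset t |: assigned mu x.
    by apply/subsetP => s; rewrite !inE ffunE; case: (s == t).
  apply: leq_trans (leq_trans (subset_leq_card sub) _) vacant.
  by rewrite cardsU1 -add1n leq_add2r leq_b1.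
apply: leq_trans (cap y); apply/subset_leq_card/subsetP => s.
rewrite !inE ffunE; case: (s == t) => // /eqP[x_y].
by rewrite x_y eqxx in y_x.
Qed.

(** The move raises the utility of [t] and changes no other outcome, so it creates no new
    preference. Only the seat newly held by [t] needs a fresh check, and there the grade of [t]
    beats every rival. *)
Lemma envy_free_reassign mu t x :
  envy_free mu -> prefers mu t x ->
  (forall s, s != t -> prefers mu s x -> grade I s x < grade I t x) ->
  envy_free (reassign mu t x).
Proof.
move=> /envy_freeP ef pref_t best; apply/envy_freeP => ti tj y.
have prefW s z : prefers (reassign mu t x) s z -> prefers mu s z.
  rewrite /prefers ffunE; case: eqP => // ->; exact: ltn_trans.
rewrite ffunE; case: (eqVneq tj t) => [-> [<-] pref | _ muy /prefW]; last exact: ef.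
(* The rival is not [t] itself: once seated in [x], [t] no longer strictly prefers [x]. *)
apply: best (prefW _ _ pref); apply/eqP => ti_t.
by move: pref; rewrite ti_t /prefers ffunE eqxx ltnn.
Qed.

(** Otherwise the sets of assigned TAs would partition [T], and the vacancy at [x] would make [#|T|]
    strictly less than the total capacity. *)
Lemma exists_unassigned mu x :
  (\sum_y capacity I y <= #|T|)%N -> within_capacity mu ->
  (#|assigned mu x| < capacity I x)%N -> exists t, mu t = None.
Proof.
move=> size /forallP cap vacant.
have [t /eqP mut | all_assigned] := pickP (fun t => mu t == None); first by exists t.
suff: (#|T| < #|T|)%N by rewrite ltnn.
apply: leq_trans size.
have -> : #|T| = (\sum_y #|assigned mu y|)%N.
  rewrite -sum1_card.
  under [RHS]eq_bigr do rewrite -sum1_card.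
  (* With the sum over TAs outermost, each TA counts once, at its own course. *)
  rewrite (exchange_big_dep xpredT) //=; apply: eq_bigr => t _.
  case mut : (mu t) => [y|]; last by move: (all_assigned t); rewrite mut.
  by rewrite (big_pred1 y) // => z; rewrite inE mut eq_sym.
rewrite (bigD1 x) //= [ltnRHS](bigD1 x) //= -addSn leq_add //.
exact: leq_sum.
Qed.

Lemma exists_envy_free_full :
  (\sum_x capacity I x <= #|T|)%N ->
  (forall t x, (0 < ta_util I t x)%N) ->
  (forall x t t', t <> t' -> grade I t x <> grade I t' x) ->
  exists2 mu, envy_free mu & forall x, #|assigned mu x| = capacity I x.
Proof.
move=> size u_gt0 g_inj.
pose ok mu := within_capacity mu && envy_free mu.
have ok0 : ok [ffun=> None].
  apply/andP; split; last by apply/envy_freeP => ti tj x; rewrite ffunE.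
  by apply/forallP => x; rewrite (_ : assigned _ x = set0) ?cards0 //;
    apply/setP => t; rewrite !inE ffunE.
case: (arg_maxnP total_util ok0) => mu /andP[cap ef] max_mu.
exists mu => // x; apply/eqP; rewrite eqn_leq (forallP cap) /= leqNgt.
apply/negP => vacant.
have [t0 mut0] := exists_unassigned mu x size cap vacant.
(* Being unassigned has utility 0, below any positive valuation. *)
have pref0 : prefers mu t0 x by rewrite /prefers mut0.
pose x_grade t := grade I t x.
case: (@arg_maxP _ _ _ t0 (prefers mu ^~ x) x_grade pref0) => t pref_t best.
suff ok_t : ok (reassign mu t x).
  by have := max_mu _ ok_t; rewrite /= leqNgt total_util_reassign.
rewrite /ok within_capacity_reassign // envy_free_reassign // => s /eqP s_t pref_s.
(* Maximality of the grade of [t] gives only a weak inequality; distinct grades make it strict. *)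
rewrite lt_neqAle [_ <= _]best // andbT; exact/eqP/g_inj.
Qed.

(** Positive integers are at least 1, so each of the [capacity I x] summands is at least 1. *)
Lemma avg_util_ge1 mu x :
  (forall t, (0 < course_util I x t)%N) -> #|assigned mu x| = capacity I x ->
  1 <= avg_util I mu x.
Proof.
move=> v_gt0 full; rewrite /avg_util mulrC ler_pdivlMr ?ltr0n ?capacity_gt0 //.
rewrite mul1r -natr_sum ler_nat -full -sum1_card.
exact: leq_sum.
Qed.

End EnvyFree.

Theorem theorem13 (X T : finType) (I : mefe_instance X T)
  (h_size : (\sum_(x : X) capacity I x <= #|T|)%N)
  (h_ta_pos : forall (t : T) (x : X), (0 < ta_util I t x)%N)
  (h_course_pos : forall (t : T) (x : X), (0 < course_util I x t)%N)
  (h_util_distinct : forall (t : T) (x y : X),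
     x <> y -> ta_util I t x <> ta_util I t y)
  (h_grade_distinct : forall (x : X) (t t' : T),
     t <> t' -> grade I t x <> grade I t' x)
  (h_k : threshold I = 1) :
  exists mu : matching X T, mefe_matching I mu.
Proof.
have [mu ef full] := exists_envy_free_full X T I h_size h_ta_pos h_grade_distinct.
exists mu; split; last exact: envy_free_merit.
- by split=> // t x _; apply/eqP; rewrite -lt0n.
- by move=> x; rewrite h_k avg_util_ge1.
Qed.
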